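(* Let $r\in\mathcal{Y}_n$. In $\mathit{LR}$ (the graded dual of $\mathcal{Y}Sym$, with basis $M^*_t$ dual to $M_t$), $$\Delta(M^*_r)=\sum_{\substack{\mathsf{R}\subseteq[n]\\ \lambda(\pi_{\mathsf{R}})\le r}}M^*_{r|_{\mathsf{R}}}\otimes M^*_{r|_{\mathsf{R}^c}}.$$
   Context: Permutations in one-line notation, products are compositions; $\mathrm{st}(a_1,..,a_p)$ is the permutation with the same relative order as distinct integers $a_i$. For $\sigma\in\mathfrak{S}_p,\tau\in\mathfrak{S}_q$: $\sigma\vee\tau=(\sigma(1)+q,..,\sigma(p)+q,p+q+1,\tau(1),..,\tau(q))$, $\sigma/\tau=(\sigma(1),..,\sigma(p),\tau(1)+p,..,\tau(q)+p)$. For $\mathsf{R}=\{R_1<\dots<R_p\}\subseteq[n]$ with complement $\mathsf{R}^c=\{R^c_1<\dots<R^c_q\}$, $\pi_{\mathsf{R}}\in\mathfrak{S}_n$ is defined by $\pi_{\mathsf{R}}^{-1}=(R_1,\dots,R_p,R^c_1,\dots,R^c_q)$ in one-line notation. For $\rho\in\mathfrak{S}_n$, $\rho|_{\mathsf{R}}=\mathrm{st}(\rho(R_1),\dots,\rho(R_p))$, and for $r\in\mathcal{Y}_n$, $r|_{\mathsf{R}}=\lambda(\gamma(r)|_{\mathsf{R}})$. Trees: $\mathcal{Y}_n$ = rooted planar binary trees with $n$ internal nodes, $\mathcal{Y}_0=\{|\}$; $s\vee t$ = root with left subtree $s$ and right subtree $t$. Tamari order: generated by replacing a subtree $(a\vee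 b)\vee c$ by the larger $a\vee(b\vee c)$. $\lambda(\mathrm{id}_0)=|$, $\lambda(\sigma)=\lambda(\mathrm{st}(\sigma(1..j-1)))\vee\lambda(\mathrm{st}(\sigma(j+1..n)))$ where $j=\sigma^{-1}(n)$; $\gamma(|)=\mathrm{id}_0$, $\gamma(t)=\gamma(t_l)\vee\gamma(t_r)$. $\mathcal{Y}Sym$: graded connected Hopf algebra over $\mathbb{Q}$ with basis $F_t$. Leaves of $t\in\mathcal{Y}_p$ numbered $0..p$; splitting at leaf $i$: $|\to(|,|)$; $t=t_l\vee t_r\to(a,b\vee t_r)$ if leaf $i$ in $t_l$ and $t_l\to(a,b)$, $\to(t_l\vee c,d)$ if in $t_r$ and $t_r\to(c,d)$. $\Delta(F_t)=\sum_iF_{t_0}\otimes F_{t_1}$. For $s\in\mathcal{Y}_q$, $F_t\cdot F_s=\sum F_{(t_0,..,t_q)/s}$ over multisets $i_1\le\dots\le i_q$ of leaves of $t$, where $t\to(t_0,..,t_q)$ splits $t$ at $i_q$ into $(t',t_q)$ and divides $t'$ at $i_1..i_{q-1}$, and $(t_0,..,t_q)/s$ grafts the root of $t_i$ onto leaf $i$ of $s$. $M_t=\sum_{t\le s}\mu_{\mathcal{Y}_n}(t,s)F_s$. The coproduct of $\mathit{LR}$ is dual to the product of $\mathcal{Y}Sym$. *)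

(* Defs.v *)
From HB Require Import structures.
From mathcomp Require Import all_boot all_order all_algebra.
Set Implicit Arguments. Unset Strict Implicit. Unset Printing Implicit Defensive.
Import GRing.Theory.

Inductive tree := Leaf | Node of tree & tree.

Fixpoint tree_eqb (t s : tree) : bool :=
  match t, s with
  | Leaf, Leaf => true
  | Node l r, Node l' r' => tree_eqb l l' && tree_eqb r r'
  | _, _ => false
  end.

Lemma tree_eqP : Equality.axiom tree_eqb.
Proof.
elim=> [|l IHl r IHr] [|l' r'] /=; try by constructor.
by case: (IHl l') => [->|H]; case: (IHr r') => [->|H'] /=; constructor;
  (try by []); case.
Qed.

HB.instance Definition _ := hasDecEq.Build tree tree_eqP.

(* number of internal nodes; t \in Y_n iff tnodes t = n *)
Fixpoint tnodes (t : tree) : nat :=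
  match t with Leaf => 0 | Node l r => (tnodes l + tnodes r).+1 end.

Fixpoint trees_h (h : nat) : seq tree :=
  match h with
  | 0 => [:: Leaf]
  | h'.+1 => Leaf :: [seq Node l r | l <- trees_h h', r <- trees_h h']
  end.

Definition trees (n : nat) : seq tree := [seq t <- trees_h n | tnodes t == n].

Fixpoint rots (t : tree) : seq tree :=
  match t with
  | Leaf => [::]
  | Node l r =>
      (if l is Node a b then [:: Node a (Node b r)] else [::])
      ++ [seq Node l' r | l' <- rots l] ++ [seq Node l r' | r' <- rots r]
  end.

Fixpoint reach (k : nat) (t : tree) : seq tree :=
  match k with
  | 0 => [:: t]
  | k'.+1 => t :: flatten [seq reach k' u | u <- rots t]
  end.

(* Tamari order: reflexive-transitive closure of the rotation step.  Since
   rotations preserve size, any reachable tree is reachable along a path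
   without repetitions, hence in fewer than #|Y_n| steps. *)
Definition tamari_le (t s : tree) : bool :=
  s \in reach (size (trees (tnodes t))) t.

(* mu(t,t) = 1, mu(t,s) = - sum_{t <= u < s} mu(t,u) for t <= s, 0 otherwise.
   Fuel: chains in Y_n have length < #|Y_n|. *)
Fixpoint mu_f (k : nat) (t s : tree) : rat :=
  match k with
  | 0 => 0%R
  | k'.+1 =>
      if s == t then 1%R
      else if tamari_le t s then
        (- \sum_(u <- trees (tnodes t) | tamari_le t u && tamari_le u s && (u != s))
            mu_f k' t u)%R
      else 0%R
  end.

Definition mobius (t s : tree) : rat :=
  if tnodes s == tnodes t then mu_f (size (trees (tnodes t))).+1 t s else 0%R.

(* a vector x : tree -> rat represents sum_t x t F_t *)
Definition vec := tree -> rat.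

(* splitting t at leaf i (leaves numbered 0..tnodes t from left to right) *)
Fixpoint split_at (t : tree) (i : nat) : tree * tree :=
  match t with
  | Leaf => (Leaf, Leaf)
  | Node l r =>
      if i < (tnodes l).+1 then
        let: (a, b) := split_at l i in (a, Node b r)
      else
        let: (c, d) := split_at r (i - (tnodes l).+1) in (Node l c, d)
  end.

(* t -> (t_0, ..., t_q) for leaves i_1 <= ... <= i_q : split at i_q into
   (t', t_q), then divide t' at i_1 .. i_{q-1} *)
Fixpoint multisplit_rev (t : tree) (ms_rev : seq nat) : seq tree :=
  match ms_rev with
  | [::] => [:: t]
  | i :: rest =>
      let: (t', tq) := split_at t i in rcons (multisplit_rev t' rest) tq
  end.

Definition multisplit (t : tree) (ms : seq nat) : seq tree :=
  multisplit_rev t (rev ms).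

Fixpoint graft_aux (s : tree) (ts : seq tree) : tree * seq tree :=
  match s with
  | Leaf => (head Leaf ts, behead ts)
  | Node l r =>
      let: (l', ts1) := graft_aux l ts in
      let: (r', ts2) := graft_aux r ts1 in (Node l' r', ts2)
  end.

Definition graft (ts : seq tree) (s : tree) : tree := (graft_aux s ts).1.

Fixpoint msets (q lo p : nat) : seq (seq nat) :=
  match q with
  | 0 => [:: [::]]
  | q'.+1 => flatten [seq [seq i :: m | m <- msets q' i p] | i <- iota lo (p.+1 - lo)]
  end.

Definition mulF (t s : tree) : vec :=
  fun u => (count (fun m => graft (multisplit t m) s == u)
                  (msets (tnodes s) 0 (tnodes t)))%:R%R.

Definition Mvec (t : tree) : vec := fun u => mobius t u.

(* product of two homogeneous elements x of degree p and y of degree q *)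
Definition mulv (p q : nat) (x y : vec) : vec :=
  fun u => (\sum_(t <- trees p) \sum_(s <- trees q) x t * y s * mulF t s u)%R.

(* ---------- permutations (one-line notation, values 1..n) ---------- *)
Definition st (a : seq nat) : seq nat :=
  [seq (count (fun y => y < x) a).+1 | x <- a].

Fixpoint lam_f (k : nat) (s : seq nat) : tree :=
  match k with
  | 0 => Leaf
  | k'.+1 =>
      if s is [::] then Leaf
      else let j := index (size s) s in
           Node (lam_f k' (st (take j s))) (lam_f k' (st (drop j.+1 s)))
  end.

Definition lam (s : seq nat) : tree := lam_f (size s).+1 s.

Definition pvee (s t : seq nat) : seq nat :=
  [seq x + size t | x <- s] ++ (size s + size t).+1 :: t.

Fixpoint gam (t : tree) : seq nat :=
  match t with Leaf => [::] | Node l r => pvee (gam l) (gam r) end.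

(* R subset of [n] is encoded as R : {set 'I_n}, i <-> i+1 *)
Definition Rl (n : nat) (R : {set 'I_n}) : seq nat := [seq (val i).+1 | i <- enum R].
Definition Rcl (n : nat) (R : {set 'I_n}) : seq nat := [seq (val i).+1 | i <- enum (~: R)].

(* pi_R, with pi_R^{-1} = (R_1..R_p, R^c_1..R^c_q) *)
Definition piR (n : nat) (R : {set 'I_n}) : seq nat :=
  [seq (if x \in Rl R then index x (Rl R) else size (Rl R) + index x (Rcl R)).+1
  | x <- iota 1 n].

(* rho|_R = st(rho(R_1), ..., rho(R_p)), for R given as increasing list *)
Definition prestr (rho : seq nat) (L : seq nat) : seq nat :=
  st [seq nth 0 rho x.-1 | x <- L].

Definition trestr (r : tree) (L : seq nat) : tree := lam (prestr (gam r) L).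

Definition coeff_count (n : nat) (r a b : tree) : nat :=
  #|[set R : {set 'I_n} | tamari_le (lam (piR R)) r
                          && (trestr r (Rl R) == a) && (trestr r (Rcl R) == b)]|.

(* Main.v *)
Require Import Defs.
From mathcomp Require Import all_boot all_order all_algebra.
From mathcomp Require Import zify ring.
Set Implicit Arguments. Unset Strict Implicit. Unset Printing Implicit Defensive.
Import GRing.Theory.

(* Number the nodes of a tree from left to right and let [lsub t] be the set of
   pairs [(i, j)] such that [i] lies in the left subtree of [j].  These are the
   non-inversions of [gam t], and [t <= s] in the Tamari order iff [lsub s] is
   included in [lsub t].  Comparing such sets shows that, when the splitting
   [(t_0, ..., t_q)] of [t] corresponds to the subset [R] of positions that the
   nodes of [t] take in [(t_0, ..., t_q) / s], one has [(t_0, ..., t_q) / s <= r]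
   iff [lam (piR R) <= r], [t <= r|R] and [s <= r|R^c].  Thus the coefficient of
   [M_r] in [F_t F_s] counts the [R] with these three properties, and Moebius
   inversion in [t] and [s] turns the last two into equalities. *)

(** * Trees as relations on their nodes *)

Fixpoint lsub (t : tree) (i j : nat) : bool :=
  if t is Node l r then
    if j < tnodes l then lsub l i j
    else if j == tnodes l then i < tnodes l
    else (tnodes l < i) && lsub r (i - (tnodes l).+1) (j - (tnodes l).+1)
  else false.

Lemma lsub_lt t i j : lsub t i j -> i < j < tnodes t.
Proof.
elim: t i j => [|l IHl r IHr] i j //=.
case: ltnP => [jl /IHl|lj]; first by lia.
by case: eqP => [->|/eqP jl /andP[li /IHr]]; lia.
Qed.

(** The left subtree of [j] occupies a block of consecutive positions ending just before [j]. *)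
Lemma lsub_interval t i x j : lsub t i j -> i <= x < j -> lsub t x j.
Proof.
elim: t i x j => [|l IHl r IHr] i x j //=.
case: ltnP => [jl lij|_]; first exact: IHl.
case: eqP => [->|_ /andP[li lij] ixj]; first by lia.
rewrite (leq_trans li) /=; last by lia.
by apply: IHr lij _; lia.
Qed.

(** The root lies in no left subtree and has every earlier node in its own. If the roots of [t] and
    [s] had different positions, the earlier one would lie in the left subtree of the later one in
    just one of the trees. Once the roots agree, the subtrees are compared recursively. *)
Lemma lsub_inj t s :
  tnodes t = tnodes s -> (forall i j, lsub t i j = lsub s i j) -> t = s.
Proof.
elim: t s => [|l IHl r IHr] [|l' r'] //= [ets] E.
have el : tnodes l = tnodes l'.
  case: (ltngtP (tnodes l) (tnodes l')) => // lt.
    have := E (tnodes l) (tnodes l'); rewrite eqxx !ltnn lt ltnNge (ltnW lt) /=.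
    by rewrite gtn_eqF.
  have := E (tnodes l') (tnodes l); rewrite eqxx !ltnn lt ltnNge (ltnW lt) /=.
  by rewrite gtn_eqF.
congr Node; [apply: IHl | apply: IHr] => // [i j||i j].
- have := E i j; rewrite el; case: (ltnP j (tnodes l')) => // lj _.
  by apply/idP/idP => /lsub_lt; lia.
- by lia.
- have := E (i + (tnodes l').+1) (j + (tnodes l').+1); rewrite el.
  have -> : (j + (tnodes l').+1 < tnodes l') = false by lia.
  have -> : (j + (tnodes l').+1 == tnodes l') = false by lia.
  have -> : (tnodes l' < i + (tnodes l').+1) by lia.
  by rewrite !addnK.
Qed.

(** * The Tamari order *)

(** The inclusion is reversed because a rotation towards a larger tree takes nodes out of a left
    subtree. *)
Definition tle (t s : tree) : Prop :=
  tnodes t = tnodes s /\ forall i j, lsub s i j -> lsub t i j.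

Lemma tle_refl t : tle t t. Proof. by []. Qed.

Lemma tle_trans s t u : tle t s -> tle s u -> tle t u.
Proof. by move=> [e1 H1] [e2 H2]; split=> [|i j /H2/H1]; first exact: etrans e2. Qed.

Lemma tle_anti t s : tle t s -> tle s t -> t = s.
Proof.
move=> [e H1] [_ H2]; apply: lsub_inj => // i j.
by apply/idP/idP; [exact: H2 | exact: H1].
Qed.

Lemma tle_Node l r l' r' : tle l l' -> tle r r' -> tle (Node l r) (Node l' r').
Proof.
move=> [el Hl] [er Hr]; split=> [|i j] /=; first by rewrite el er.
rewrite el; case: ltnP => _; first exact: Hl.
by case: eqP => // _ /andP[->]; exact: Hr.
Qed.

(** The pairs that get lost are those from [a], or from the root between [a] and [b], to the root
    between [b] and [c]; no pair is gained. *)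
Lemma tle_rot a b c : tle (Node (Node a b) c) (Node a (Node b c)).
Proof.
split=> [|i j] /=; first by lia.
have E k : k - (tnodes a).+1 - (tnodes b).+1 = k - (tnodes a + tnodes b).+2 by lia.
case: (ltnP j (tnodes a)) => [ja|aj]; first by rewrite ifT //; lia.
case: eqP => [->|/eqP ja]; first by rewrite ifT //; lia.
case/andP=> ai.
case: (ltnP j (tnodes a + tnodes b).+1) => [jb|bj].
  by rewrite ifT ?ai //; lia.
rewrite ifF; last by lia.
case: eqP => [ejb|/eqP jb]; first by rewrite ifT; lia.
rewrite ifF; last by lia.
by rewrite !E => /andP[bi ->]; rewrite andbT; lia.
Qed.

Lemma tle_rots t u : u \in rots t -> tle t u.
Proof.
elim: t u => [|l IHl r IHr] u //=.
rewrite !mem_cat => /or3P[|/mapP[v vl ->]|/mapP[v vr ->]].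
- by case: l {IHl} => // a b; rewrite inE => /eqP ->; exact: tle_rot.
- by apply: tle_Node; [exact: IHl | exact: tle_refl].
- by apply: tle_Node; [exact: tle_refl | exact: IHr].
Qed.

(** * Rotation paths realise the inclusion order *)

Definition rotrel : rel tree := [rel t u | u \in rots t].

Definition rotates (t s : tree) := exists2 p, path rotrel t p & s = last t p.

Lemma rotates_refl t : rotates t t. Proof. by exists [::]. Qed.

Lemma rotates_trans s t u : rotates t s -> rotates s u -> rotates t u.
Proof.
move=> [p pp ->] [p' pp' ->]; exists (p ++ p'); last by rewrite last_cat.
by rewrite cat_path pp.
Qed.

Lemma rotates1 t u : u \in rots t -> rotates t u.
Proof. by move=> tu; exists [:: u] => //; rewrite /= andbT. Qed.

Lemma rotates_Node l r l' r' :
  rotates l l' -> rotates r r' -> rotates (Node l r) (Node l' r').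
Proof.
move=> [p pp ->] [p' pp' ->].
have Hl x y c : rotrel x y -> rotrel (Node x c) (Node y c).
  by rewrite /rotrel /= => xy; rewrite !mem_cat (map_f (Node^~ c)) // orbT.
have Hr x y c : rotrel x y -> rotrel (Node c x) (Node c y).
  by rewrite /rotrel /= => xy; rewrite !mem_cat (map_f (Node c)) // !orbT.
apply: (@rotates_trans (Node (last l p) r)).
  exists (map (Node^~ r) p); last by rewrite (last_map (Node^~ r)).
  by apply: (homo_path (f := Node^~ r)) pp => x y; exact: Hl.
exists (map (Node (last l p)) p'); last by rewrite last_map.
by apply: homo_path pp' => x y; exact: Hr.
Qed.

Lemma tle_path t p : path rotrel t p -> tle t (last t p).
Proof.
elim: p t => [|u p IHp] t /=; first by move=> _; exact: tle_refl.
by move=> /andP[/tle_rots tu /IHp]; exact: tle_trans.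
Qed.

(* A node of the left spine can be rotated up to the root, which only removes
   the pairs [(i, j)] with [i <= k < j]. *)
Lemma rotate_to_root t k :
  k < tnodes t -> (forall i, i < k -> lsub t i k) ->
  exists a b, [/\ rotates t (Node a b), tnodes a = k
    & forall i j, lsub t i j -> (k < j -> k < i) -> lsub (Node a b) i j].
Proof.
elim: t k => [|l IHl r _] k //= kt spine.
case: (ltngtP k (tnodes l)) => [kl|lk|ek]; last first.
- by exists l, r; split=> //; exact: rotates_refl.
- by have := spine _ lk; rewrite ltnn ltnNge ltnW //= gtn_eqF.
have [|a [b [lab ak H]]] := IHl k kl.
  by move=> i /spine; rewrite kl.
have tl : tle l (Node a b) by case: lab => p /tle_path + ->.
exists a, (Node b r); split=> //.
  apply: (@rotates_trans (Node (Node a b) r)).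
    by apply: rotates_Node => //; exact: rotates_refl.
  by apply: rotates1; rewrite /= inE eqxx.
have El := tl.1; rewrite /= in El.
have E x : x - (tnodes a).+1 - (tnodes b).+1 = x - (tnodes a + tnodes b).+2 by lia.
move=> i j; rewrite /= El => lij kji.
move: lij; case: (ltnP j) => [jl lij|lj].
  have := H _ _ lij kji; rewrite /=; case: ifP => // ja; case: ifP => // ja'.
  by rewrite ifT //; lia.
case: eqP => [ej il|/eqP jl /andP[li rij]].
  have -> : (j < tnodes a) = false by lia.
  have -> : (j == tnodes a) = false by lia.
  have -> : (j - (tnodes a).+1 < tnodes b) = false by lia.
  by rewrite ifT; lia.
have -> : (j < tnodes a) = false by lia.
have -> : (j == tnodes a) = false by lia.
have -> : (j - (tnodes a).+1 < tnodes b) = false by lia.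
have -> : (j - (tnodes a).+1 == tnodes b) = false by lia.
by rewrite !E rij; lia.
Qed.

(** For the converse, let [k] be the position of the root of [s]. Inclusion forces all nodes before
    [k] into the left subtree of [k] in [t], so [k] can be rotated to the root of [t]. The pairs
    destroyed pass over [k], and [s] has no such pair; hence the inclusion survives and induction
    applies to both subtrees. *)
Lemma rotates_tle t s : rotates t s <-> tle t s.
Proof.
split=> [[p /tle_path + ->] //|].
elim: s t => [|l IHl r IHr] t [ets H].
  by case: t ets {H} => // _; exact: rotates_refl.
have [||a [b [tab al Hab]]] := @rotate_to_root t (tnodes l).
- by rewrite ets /=; lia.
- by move=> i il; apply: H; rewrite /= ltnn eqxx.
have eb : tnodes b = tnodes r.
  have [] : tle t (Node a b) by case: tab => p /tle_path + ->.
  by move=> + _; rewrite ets /= al; lia.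
apply: rotates_trans tab _; apply: rotates_Node.
  apply: IHl; split=> // i j lij; have /andP[_ jl] := lsub_lt lij.
  have /Hab : lsub t i j by apply: H; rewrite /= jl.
  by rewrite /= al jl; apply; lia.
apply: IHr; split=> // i j rij.
have := Hab (i + (tnodes l).+1) (j + (tnodes l).+1).
have E : lsub (Node l r) (i + (tnodes l).+1) (j + (tnodes l).+1).
  by rewrite /= ifF ?ifF ?addnK ?rij ?andbT; lia.
by move=> /(_ (H _ _ E)); rewrite /= al ifF ?ifF ?addnK; lia.
Qed.

(** * Enumeration of trees and decidability of the order *)

Lemma mem_trees t n : (t \in trees n) = (tnodes t == n).
Proof.
rewrite mem_filter; case: eqP => //= <-.
(* The bound [h] limits the height, which never exceeds the number of nodes. *)
suff H h : tnodes t <= h -> t \in trees_h h by exact: H.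
elim: h t => [|h IHh] [|l r] //=; rewrite ltnS => lh.
rewrite inE /=; apply/allpairsP; exists (l, r) => /=.
by split=> //; apply: IHh; apply: leq_trans lh; rewrite ?leq_addr ?leq_addl.
Qed.

Lemma trees_uniq n : uniq (trees n).
Proof.
rewrite filter_uniq //; elim: {1}n => //= h IHh.
rewrite allpairs_uniq //; last by move=> [l r] [l' r'] _ _ [-> ->].
by rewrite andbT; apply/negP=> /allpairsP[[l r] []].
Qed.

Lemma mem_reach k t s :
  s \in reach k t <-> exists p, [/\ path rotrel t p, size p <= k & s = last t p].
Proof.
elim: k t s => [|k IHk] t s /=.
  rewrite inE; split=> [/eqP->|[[|u p] [//= _ _ ->]]] //.
  by exists [::].
rewrite inE; split=> [/orP[/eqP->|/flatten_mapP[u tu /IHk[p [pp pk ->]]]]|].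
- by exists [::].
- by exists (u :: p); split=> //=; apply/andP.
case=> [[|u p] [/= pp pk ->]]; first by rewrite eqxx.
case/andP: pp => tu pp; apply/orP; right.
by apply/flatten_mapP; exists u => //; apply/IHk; exists p.
Qed.

(** The fuel of [reach] suffices: a path can be made free of repetitions, and all its vertices
    belong to [trees (tnodes t)]. *)
Lemma tamariP t s : reflect (tle t s) (tamari_le t s).
Proof.
apply: (iffP idP) => [/mem_reach[p [pp _ ->]]|/rotates_tle[p pp ->]].
  by apply/rotates_tle; exists p.
apply/mem_reach; case: (shortenP pp) => p' pp' up' _; exists p'; split=> //.
move: up' => /= /andP[_ up']; apply: uniq_leq_size => // x xp'.
(* The initial segment ending at [x] is itself a rotation path, so [x] has as many nodes as [t]. *)
case/splitPr: xp' pp' {up'} => p1 p2; rewrite -cat_rcons cat_path => /andP[pp1 _].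
suff [etx _] : tle t x by rewrite mem_trees etx.
by apply/rotates_tle; exists (rcons p1 x); rewrite ?last_rcons.
Qed.

(** * Splitting and grafting *)

Lemma split_at_Node l r i :
  split_at (Node l r) i =
  if i < (tnodes l).+1
  then ((split_at l i).1, Node (split_at l i).2 r)
  else (Node l (split_at r (i - (tnodes l).+1)).1,
        (split_at r (i - (tnodes l).+1)).2).
Proof. by rewrite /=; case: ifP => _; case: (split_at _ _). Qed.

Local Arguments split_at : simpl never.

Lemma tnodes_split1 t i : i <= tnodes t -> tnodes (split_at t i).1 = i.
Proof.
elim: t i => [|l IHl r IHr] i; first by case: i.
rewrite split_at_Node /=; case: ltnP => li ir /=; first exact: IHl.
by rewrite IHr; lia.
Qed.

Lemma tnodes_split2 t i : i <= tnodes t -> tnodes (split_at t i).2 = tnodes t - i.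
Proof.
elim: t i => [|l IHl r IHr] i; first by case: i.
rewrite split_at_Node /=; case: ltnP => li ir /=; first by rewrite IHl; lia.
by rewrite IHr; lia.
Qed.

(** Leaf [i] lies between the nodes [i - 1] and [i], so the two pieces carry the nodes before and
    after it. A cut does not change which nodes of a piece lie in the left subtree of which
    others. *)
Lemma lsub_split1 t i a b :
  i <= tnodes t -> b < i -> lsub (split_at t i).1 a b = lsub t a b.
Proof.
elim: t i a b => [|l IHl r IHr] i a b; first by case: i.
rewrite split_at_Node /=; case: (ltnP i) => li ir bi /=.
  by rewrite IHl //; case: ltnP => //; lia.
case: ltnP => // lb; case: eqP => // /eqP nb.
by rewrite IHr //; lia.
Qed.

Lemma lsub_split2 t i a b :
  i <= tnodes t -> lsub (split_at t i).2 a b = lsub t (a + i) (b + i).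
Proof.
elim: t i a b => [|l IHl r IHr] i a b; first by case: i.
rewrite split_at_Node /=; case: (ltnP i) => li ir /=.
  rewrite tnodes_split2 // IHl //.
  have -> : (b < tnodes l - i) = (b + i < tnodes l) by lia.
  have -> : (b == tnodes l - i) = (b + i == tnodes l) by lia.
  have -> : (a < tnodes l - i) = (a + i < tnodes l) by lia.
  have -> : (tnodes l - i < a) = (tnodes l < a + i) by lia.
  have -> : (a - (tnodes l - i).+1) = a + i - (tnodes l).+1 by lia.
  by have -> : (b - (tnodes l - i).+1) = b + i - (tnodes l).+1 by lia.
rewrite IHr; last by lia.
rewrite ifF; last by lia.
rewrite ifF; last by lia.
have -> : tnodes l < a + i by lia.
by rewrite /= !addnBA.
Qed.

(** Cuts at two leaves commute and leave three pieces; leaf [k] of [t] becomes leaf [k - i] of the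
    piece to the right of [i]. The third piece is treated in [split_split2]. *)
Lemma split_split1 t i k : i <= k -> k <= tnodes t ->
  split_at (split_at t k).1 i =
    ((split_at t i).1, (split_at (split_at t i).2 (k - i)).1).
Proof.
elim: t i k => [|l IHl r IHr] i k // ik kt.
rewrite !(split_at_Node l r); move: kt => /= kt.
case: (ltnP k) => kl /=.
  have il : i <= tnodes l by lia.
  rewrite ltnS il IHl //= split_at_Node tnodes_split2 // ifT //; lia.
rewrite split_at_Node; case: (ltnP i) => il /=.
  rewrite split_at_Node tnodes_split2 // ifF /=; last by lia.
  by have -> : k - i - (tnodes l - i).+1 = k - (tnodes l).+1 by lia.
rewrite IHr /=; try lia.
by have -> : k - (tnodes l).+1 - (i - (tnodes l).+1) = k - i by lia.
Qed.

Lemma split_split2 t i k : i <= k -> k <= tnodes t ->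
  (split_at t k).2 = (split_at (split_at t i).2 (k - i)).2.
Proof.
elim: t i k => [|l IHl r IHr] i k // ik kt.
rewrite !(split_at_Node l r); move: kt => /= kt.
case: (ltnP k) => kl /=.
  have il : i <= tnodes l by lia.
  by rewrite ltnS il (IHl i) //= split_at_Node tnodes_split2 // ifT //; lia.
case: (ltnP i) => il /=.
  rewrite split_at_Node tnodes_split2 // ifF /=; last by lia.
  by have -> : k - i - (tnodes l - i).+1 = k - (tnodes l).+1 by lia.
rewrite (IHr (i - (tnodes l).+1)) /=; try lia.
by have -> : k - (tnodes l).+1 - (i - (tnodes l).+1) = k - i by lia.
Qed.

Lemma multisplit_rcons t m k :
  multisplit t (rcons m k) =
  rcons (multisplit (split_at t k).1 m) (split_at t k).2.
Proof. by rewrite /multisplit rev_rcons /=; case: split_at. Qed.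

Lemma size_multisplit t m : size (multisplit t m) = (size m).+1.
Proof.
by elim/last_ind: m t => // m k IHm t; rewrite multisplit_rcons !size_rcons IHm.
Qed.

Lemma sorted_rcons_leq m k :
  sorted leq (rcons m k) -> sorted leq m /\ all (leq^~ k) m.
Proof.
rewrite !(sorted_pairwise leq_trans) -cats1 pairwise_cat allrel1r.
by case/and3P.
Qed.

(** Making the cut at a middle leaf first separates the others into two independent splittings. With
    [i] the leaf attached to the root of [s], this is what allows induction on [s]. *)
Lemma multisplit_cat t m1 i m2 :
  i <= tnodes t -> sorted leq m2 -> all (leq^~ (tnodes t - i)) m2 ->
  multisplit t (m1 ++ i :: [seq i + k | k <- m2]) =
  multisplit (split_at t i).1 m1 ++ multisplit (split_at t i).2 m2.
Proof.
elim/last_ind: m2 t => [|m2 k IHm] t it sm am /=.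
  by rewrite cats1 multisplit_rcons /multisplit /= cats1.
have [sm2 am2] := sorted_rcons_leq sm.
move: am; rewrite all_rcons => /andP[kt _].
have ikt : i + k <= tnodes t by lia.
rewrite map_rcons -rcons_cons -rcons_cat !multisplit_rcons -rcons_cat.
rewrite IHm ?tnodes_split1 ?leq_addr ?addKn //.
rewrite split_split1 ?leq_addr //= addKn; congr rcons.
by rewrite (@split_split2 _ i) ?leq_addr // addKn.
Qed.

(** Grafting consumes the list from the left, one tree per leaf of [s], and passes any surplus on
    unchanged. *)
Lemma graft_aux_cat s ts rest : tnodes s < size ts ->
  graft_aux s (ts ++ rest) = ((graft_aux s ts).1, (graft_aux s ts).2 ++ rest)
  /\ size (graft_aux s ts).2 = size ts - (tnodes s).+1.
Proof.
elim: s ts rest => [|l IHl r IHr] ts rest /=.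
  by case: ts => //= t ts _; rewrite subn1.
move=> st; have [|-> sl] := IHl ts rest; first by lia.
case: (graft_aux l ts) sl => l' ts1 /= sl.
have [|-> sr] := IHr ts1 rest; first by lia.
by case: (graft_aux r ts1) sr => r' ts2 /= sr; split=> //; lia.
Qed.

Lemma graft_Node ts1 ts2 l r :
  size ts1 = (tnodes l).+1 ->
  graft (ts1 ++ ts2) (Node l r) = Node (graft ts1 l) (graft ts2 r).
Proof.
move=> s1; rewrite /graft /=.
have [|-> sl] := @graft_aux_cat l ts1 ts2; first by rewrite s1.
have /size0nil -> : size (graft_aux l ts1).2 = 0 by lia.
by rewrite cat0s; case: (graft_aux r ts2).
Qed.

(** * Shuffles of two trees *)

(* A word [w] encodes the subset of positions carrying [true]; the [k]-th entry
   of [mask_mset 0 w] is the number of [true]s before the [k]-th [false], that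
   is the leaf of the first tree at which the [k]-th splitting occurs. *)
Fixpoint mask_mset (lo : nat) (w : seq bool) : seq nat :=
  match w with
  | [::] => [::]
  | true :: w' => mask_mset lo.+1 w'
  | false :: w' => lo :: mask_mset lo w'
  end.

(** Inverse encoding to [mask_mset]. The trailing [true]s bring their number up to [p - lo], which
    the list alone does not record. *)
Fixpoint mset_mask (lo p : nat) (m : seq nat) : seq bool :=
  if m is i :: m' then nseq (i - lo) true ++ false :: mset_mask i p m'
  else nseq (p - lo) true.

Lemma mask_mset_cat lo w1 w2 :
  mask_mset lo (w1 ++ w2) = mask_mset lo w1 ++ mask_mset (lo + count id w1) w2.
Proof.
elim: w1 lo => [|[] w1 IHw] lo /=; first by rewrite addn0.
  by rewrite IHw addSnnS.
by rewrite IHw.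
Qed.

Lemma mask_msetD d lo w :
  mask_mset (d + lo) w = [seq d + k | k <- mask_mset lo w].
Proof. by elim: w lo => [|[] w IHw] lo //=; rewrite -?addnS IHw. Qed.

Lemma size_mask_mset lo w : size (mask_mset lo w) = count negb w.
Proof. by elim: w lo => [|[] w IHw] lo //=; rewrite IHw. Qed.

Lemma path_mask_mset lo w : path leq lo (mask_mset lo w).
Proof.
elim: w lo => [|[] w IHw] lo //=; last by rewrite leqnn IHw.
by case: (mask_mset _ _) (IHw lo.+1) => //= i m /andP[/ltnW -> ->].
Qed.

Lemma mask_mset_le lo w : all (leq^~ (lo + count id w)) (mask_mset lo w).
Proof.
elim: w lo => [|[] w IHw] lo //=; first by rewrite addnA addn1.
by rewrite leq_addr IHw.
Qed.

Lemma mask_msetK lo w : mset_mask lo (lo + count id w) (mask_mset lo w) = w.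
Proof.
elim: w lo => [|[] w IHw] lo /=; first by rewrite addn0 subnn.
  rewrite -[in RHS](IHw lo.+1) addnA addn1.
  case: (mask_mset _ _) (path_mask_mset lo.+1 w) => [|i m] /= => [_|/andP[li _]].
    by have -> : lo.+1 + count id w - lo = (lo.+1 + count id w - lo.+1).+1 by lia.
  by have -> : i - lo = (i - lo.+1).+1 by lia.
by rewrite subnn IHw.
Qed.

Lemma mask_mset_nseq lo k w :
  mask_mset lo (nseq k true ++ w) = mask_mset (lo + k) w.
Proof. by elim: k lo => [|k IHk] lo /=; rewrite ?addn0 // IHk addSnnS. Qed.

Lemma mset_maskK lo p m : path leq lo m -> mask_mset lo (mset_mask lo p m) = m.
Proof.
elim: m lo => [|i m IHm] lo /=.
  by rewrite -[nseq _ _]cats0 mask_mset_nseq.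
by move=> /andP[li pm]; rewrite mask_mset_nseq subnKC //= IHm.
Qed.

Lemma count_mset_mask lo p m : path leq lo m -> all (leq^~ p) m -> lo <= p ->
  count id (mset_mask lo p m) = p - lo /\ count negb (mset_mask lo p m) = size m.
Proof.
elim: m lo => [|i m IHm] lo /=.
  by rewrite !count_nseq /= mul1n mul0n.
move=> /andP[li pm] /andP[ip am] lp; have [e1 e2] := IHm i pm am ip.
rewrite !count_cat !count_nseq /= e1 e2; lia.
Qed.

Lemma mem_msets q lo p m :
  (m \in msets q lo p) = [&& size m == q, path leq lo m & all (leq^~ p) m].
Proof.
elim: q lo m => [|q IHq] lo m /=; first by case: m.
apply/flatten_mapP/idP => [[i + /mapP[m' + ->]]|].
  by rewrite mem_iota IHq /= eqSS => li /and3P[-> -> ->]; lia.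
case: m => //= i m /and3P[sm /andP[li pm] /andP[ip am]].
exists i; first by rewrite mem_iota; lia.
by apply: map_f; rewrite IHq pm am -eqSS sm.
Qed.

Lemma msets_uniq q lo p : uniq (msets q lo p).
Proof.
elim: q lo => //= q IHq lo.
by apply: allpairs_uniq_dep => [|i _|[i m] [i' m'] _ _ [-> ->]] //; exact: iota_uniq.
Qed.

(** For [k = tnodes l], the [false] found here is the position that the root of [Node l r] takes in
    a shuffle. *)
Lemma split_mask k w : k < count negb w ->
  exists w1 w2, w = w1 ++ false :: w2 /\ count negb w1 = k.
Proof.
elim: w k => [|[] w IHw] k //=.
  rewrite add0n => /IHw[w1 [w2 [-> <-]]]; exists (true :: w1), w2.
  by rewrite /= add0n.
case: k => [_|k]; first by exists [::], w.
rewrite add1n ltnS => /IHw[w1 [w2 [-> <-]]]; exists (false :: w1), w2.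
by rewrite /= add1n.
Qed.

Definition shuffle (t s : tree) (w : seq bool) : tree :=
  graft (multisplit t (mask_mset 0 w)) s.

(** The displayed [false] is the root of [Node l r]. The cut belonging to it is at leaf
    [count id w1] of [t], and the cuts that follow are renumbered from there by [mask_msetD]. *)
Lemma shuffle_Node t l r w1 w2 :
  count id (w1 ++ false :: w2) = tnodes t -> count negb w1 = tnodes l ->
  shuffle t (Node l r) (w1 ++ false :: w2) =
  Node (shuffle (split_at t (count id w1)).1 l w1)
       (shuffle (split_at t (count id w1)).2 r w2).
Proof.
rewrite count_cat /= add0n => ct c1.
rewrite /shuffle mask_mset_cat /= add0n -{2}[count id w1]addn0 mask_msetD.
have it : count id w1 <= tnodes t by lia.
rewrite multisplit_cat //.
- by rewrite graft_Node // size_multisplit size_mask_mset c1.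
- exact: path_sorted (path_mask_mset 0 w2).
- by rewrite -ct addKn; exact: mask_mset_le.
Qed.

Lemma tnodes_shuffle t s w :
  count id w = tnodes t -> count negb w = tnodes s ->
  tnodes (shuffle t s w) = size w.
Proof.
elim: s t w => [|l IHl r IHr] t w ct cs.
  rewrite -(count_predC id w) ct (eq_count (_ : _ =1 negb)) // cs addn0.
  have /size0nil em : size (mask_mset 0 w) = 0 by rewrite size_mask_mset.
  by rewrite /shuffle em.
have [|w1 [w2 [ew c1]]] := @split_mask (tnodes l) w; first by rewrite cs /=; lia.
move: ct cs; rewrite ew count_cat /= count_cat /= add0n add1n => ct cs.
rewrite shuffle_Node //=; last by rewrite count_cat.
rewrite IHl ?tnodes_split1 //; try lia.
rewrite IHr ?tnodes_split2 //; try lia.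
by rewrite size_cat /= addnS.
Qed.

Lemma count_take_le (T : Type) (P : pred T) k w : count P (take k w) <= count P w.
Proof. by rewrite -{2}(cat_take_drop k w) count_cat leq_addr. Qed.

Lemma count_take_lt (T : Type) x0 (P : pred T) k w :
  k < size w -> P (nth x0 w k) -> count P (take k w) < count P w.
Proof.
move=> kw Pk; rewrite -{2}(cat_take_drop k w) count_cat (drop_nth x0) //= Pk.
by rewrite add1n addnS ltnS leq_addr.
Qed.

(** A position preceded by [k] [false]s lies in the piece grafted onto leaf [k] of [s], or is node
    [k] of [s]. The left subtree of a node of [t] stays inside its piece. For a node [k'] of [s],
    leaf [k] with [k <= k'] lies in its left subtree iff [k = k'] or node [k] does. *)
Lemma lsub_shuffle t s w i j :
  count id w = tnodes t -> count negb w = tnodes s -> i < j < size w ->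
  lsub (shuffle t s w) i j =
  if nth false w j then
    (count negb (take i w) == count negb (take j w)) &&
    lsub t (count id (take i w)) (count id (take j w))
  else
    (count negb (take i w) == count negb (take j w)) ||
    lsub s (count negb (take i w)) (count negb (take j w)).
Proof.
elim: s t w i j => [|l IHl r IHr] t w i j ct cs ij.
  have /size0nil em : size (mask_mset 0 w) = 0 by rewrite size_mask_mset.
  have /all_pred1P ew : all (pred1 true) w.
    have := has_count negb w; rewrite cs /= => /negbT; rewrite -all_predC.
    by apply: sub_all => [[]].
  have E k P : k < size w -> count P (take k w) = P true * k.
    by move=> kw; rewrite ew take_nseq ?size_nseq ?count_nseq // ltnW.
  rewrite /shuffle em /multisplit /= /graft /=.
  have -> : nth false w j by rewrite ew nth_nseq ifT //; case/andP: ij.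
  by rewrite !E ?mul1n ?mul0n //; lia.
have [|w1 [w2 [ew c1]]] := @split_mask (tnodes l) w; first by rewrite cs /=; lia.
move: ct cs ij; rewrite ew count_cat /= count_cat /= add0n add1n => ct cs.
rewrite shuffle_Node //=; last by rewrite count_cat.
have it : count id w1 <= tnodes t by lia.
have t1 : count id w1 = tnodes (split_at t (count id w1)).1.
  by rewrite tnodes_split1.
have t2 : count id w2 = tnodes (split_at t (count id w1)).2.
  by rewrite tnodes_split2 // -ct addKn.
have c2 : count negb w2 = tnodes r by lia.
rewrite tnodes_shuffle // size_cat /= => ij.
(* The root of [s] sits at position [size w1]. *)
case: (ltngtP j (size w1)) => [j1|j1|ej].
- rewrite IHl //; last by lia.
  rewrite nth_cat j1 !takel_cat; try lia.
  case: ifP => wj.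
    by rewrite lsub_split1 // (@count_take_lt _ false) ?wj.
  by rewrite ifT // -c1 (@count_take_lt _ false) ?wj.
- rewrite nth_cat !take_cat; have -> : (j < size w1) = false by lia.
  have ej : j - size w1 = (j - (size w1).+1).+1 by lia.
  rewrite ej /= !(count_cat _ w1) /= !add0n add1n c1.
  case: (ltnP (size w1) i) => i1 /=; last first.
    rewrite -take_cat takel_cat //.
    have := count_take_le negb i w1; rewrite c1 => Fi.
    case: ifP => _; last rewrite ifF ?ifF; lia.
  have -> : (i < size w1) = false by lia.
  have ei : i - size w1 = (i - (size w1).+1).+1 by lia.
  rewrite ei /= !count_cat /= !add0n !add1n c1 IHr //; last by lia.
  rewrite lsub_split2 // !eqn_add2l eqSS.
  rewrite [X in lsub t X]addnC [X in lsub t _ X]addnC.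
  case: ifP => // _; rewrite ifF ?ifF; try lia.
  by rewrite !addnS ltnS leq_addr !subSS !addKn.
- rewrite ej nth_cat ltnn subnn /= (take_size_cat _ (erefl (size w1))) takel_cat; last by lia.
  rewrite c1 ltnn eqxx -leq_eqVlt.
  by have := count_take_le negb i w1; lia.
Qed.

(** * Permutations *)

Lemma size_gam t : size (gam t) = tnodes t.
Proof.
elim: t => //= l IHl r IHr.
by rewrite /pvee size_cat size_map /= IHl IHr addnS.
Qed.

Lemma gam_bound t x : x \in gam t -> 0 < x <= tnodes t.
Proof.
elim: t x => //= l IHl r IHr x.
rewrite /pvee mem_cat inE !size_gam => /or3P[/mapP[y /IHl + ->]|/eqP->|/IHr]; lia.
Qed.

Lemma gam_uniq t : uniq (gam t).
Proof.
elim: t => //= l IHl r IHr; rewrite /pvee cat_uniq /= IHr andbT !size_gam.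
rewrite (map_inj_uniq (@addIn _)) IHl negb_or /= -andbA; apply/and3P; split.
- by apply/mapP=> -[y /gam_bound]; lia.
- apply/hasPn=> x /gam_bound xr; apply/mapP=> -[y /gam_bound]; lia.
- by apply/negP=> /gam_bound; lia.
Qed.

(** In [pvee] the root has the largest value and every value on its left exceeds every value on its
    right. Hence an increasing pair lies within one side or ends at the root. *)
Lemma lsub_gam t i j : i < j < tnodes t ->
  (nth 0 (gam t) i < nth 0 (gam t) j) = lsub t i j.
Proof.
elim: t i j => [|l IHl r IHr] i j /=; first by lia.
have bnd u k : k < tnodes u -> 0 < nth 0 (gam u) k <= tnodes u.
  by move=> ku; apply: gam_bound; rewrite mem_nth ?size_gam.
move=> ij; rewrite /pvee !nth_cat !size_map !size_gam.
case: (ltngtP j (tnodes l)) => [jl|jl|ej].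
- have il : i < tnodes l by lia.
  by rewrite il !(nth_map 0) ?size_gam // ltn_add2r IHl //; lia.
- have ejl : j - tnodes l = (j - (tnodes l).+1).+1 by lia.
  rewrite ejl /=; have := bnd r (j - (tnodes l).+1).
  case: (ltngtP i (tnodes l)) => [il|il|ei] /=.
  + by rewrite (nth_map 0) ?size_gam //; lia.
  + have -> : i - tnodes l = (i - (tnodes l).+1).+1 by lia.
    by rewrite /= IHr //; lia.
  + by rewrite ei subnn /=; lia.
- have il : i < tnodes l by lia.
  rewrite il ej subnn /= (nth_map 0) ?size_gam //.
  by have := bnd l i il; lia.
Qed.

Lemma size_st a : size (st a) = size a.
Proof. exact: size_map. Qed.

Lemma sub_count_lt (T : eqType) (P Q : pred T) (x : T) (s : seq T) :
  subpred P Q -> x \in s -> Q x -> ~~ P x -> count P s < count Q s.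
Proof.
move=> PQ xs Qx nPx; rewrite !(permP (perm_to_rem xs)) /= Qx (negbTE nPx).
by rewrite add0n add1n ltnS sub_count.
Qed.

Lemma nth_st_lt a i j : i < size a -> j < size a ->
  (nth 0 (st a) i < nth 0 (st a) j) = (nth 0 a i < nth 0 a j).
Proof.
move=> ia ja; rewrite !(nth_map 0) // ltnS.
have mono x y : x <= y ->
    count (fun z => z < x) a <= count (fun z => z < y) a.
  by move=> xy; apply: sub_count => z /= zx; exact: leq_trans xy.
apply/idP/idP => [|lt]; first by rewrite !ltnNge; apply: contra; exact: mono.
apply: (@sub_count_lt _ _ _ (nth 0 a i)) => [z /= zi|||]; rewrite ?mem_nth ?ltnn //.
exact: ltn_trans lt.
Qed.

(** Distinctness and the bounds together say that [s] is the one-line notation of a permutation. *)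
Definition standard (s : seq nat) :=
  uniq s && all (fun x => 0 < x <= size s) s.

Lemma st_standard a : uniq a -> standard (st a).
Proof.
move=> ua; apply/andP; split.
  apply/(uniqP 0) => i j; rewrite !inE size_st => ia ja eij.
  have := nth_st_lt ia ja; have := nth_st_lt ja ia; rewrite eij ltnn => nji nij.
  apply: (uniqP 0 ua); rewrite ?inE //.
  by case: (ltngtP (nth 0 a i) (nth 0 a j)) nij nji.
apply/allP=> _ /mapP[x xa ->]; rewrite size_st /=.
rewrite -(count_predC (fun y => y < x) a) -[X in X < _]addn0 ltn_add2l.
by rewrite -has_count; apply/hasP; exists x; rewrite //= ltnn.
Qed.

Lemma standard_mem_size s : standard s -> s != [::] -> size s \in s.
Proof.
move=> /andP[us /allP bs] s0.
have [] := @uniq_min_size _ s (iota 1 (size s)).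
- exact: us.
- by move=> x /bs; rewrite mem_iota; lia.
- by rewrite size_iota.
by move=> _ ->; rewrite mem_iota; case: s s0 {us bs} => //= x s _; lia.
Qed.

(** [lam_f] builds the decreasing tree, with the maximum at the root. A node [i] lies in the left
    subtree of [j] exactly when [j] carries the maximum of the window from [i] to [j]. *)
Lemma lam_fP k s : standard s -> size s <= k ->
  tnodes (lam_f k s) = size s /\
  forall i j, lsub (lam_f k s) i j <->
    i < j < size s /\ forall x, i <= x < j -> nth 0 s x < nth 0 s j.
Proof.
elim: k s => [|k IHk] s ss sk.
  have /size0nil -> : size s = 0 by lia.
  by split=> // i j; split=> [|[]] //=; lia.
case: (altP (s =P [::])) => [->|s0]; first by split=> // i j; split=> [|[]] //=; lia.
have sz := standard_mem_size ss s0; move: ss => /andP[us /allP bs].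
pose m := index (size s) s.
have -> : lam_f k.+1 s =
    Node (lam_f k (st (take m s))) (lam_f k (st (drop m.+1 s))).
  by rewrite /m; case: (s) s0.
have ms : m < size s by rewrite index_mem.
have nm : nth 0 s m = size s by exact: nth_index.
have lt x : x < size s -> x != m -> nth 0 s x < size s.
  move=> xs xm; rewrite ltn_neqAle -{1}nm nth_uniq // xm.
  by have /andP[] := bs _ (mem_nth 0 xs).
have [||tl Hl] := IHk (st (take m s)).
- by apply/st_standard/take_uniq.
- by rewrite size_st size_take ms; lia.
rewrite size_st size_take ms in tl Hl.
have [||tr Hr] := IHk (st (drop m.+1 s)).
- by apply/st_standard/drop_uniq.
- by rewrite size_st size_drop; lia.
rewrite size_st size_drop in tr Hr.
split; first by rewrite /= tl tr; lia.
move=> i j; rewrite /= tl; case: (ltngtP j m) => [jm|mj|ej].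
- rewrite Hl; split=> -[ij H]; split; try lia.
    move=> x xij; have := H x xij.
    by rewrite nth_st_lt ?size_take ?ms ?nth_take //; lia.
  move=> x xij; rewrite nth_st_lt ?size_take ?ms ?nth_take //; try lia.
  exact: H.
- split=> [/andP[mi /Hr[ij H]]|[ij H]].
    split; first by lia.
    move=> x xij; have := H (x - m.+1).
    by rewrite nth_st_lt ?size_drop ?nth_drop ?subnKC; lia.
  (* A window containing [m] would have its maximum at [m] and not at [j]. *)
  have mi : m < i.
    rewrite ltnNge; apply/negP=> im; have := H m; rewrite nm im mj => /(_ isT).
    by have := lt j; lia.
  rewrite mi; apply/Hr; split; first by lia.
  move=> x xij; rewrite nth_st_lt ?size_drop ?nth_drop ?(subnKC mj); try lia.
  by apply: H; lia.
- rewrite ej; split=> [im|[]]; last by lia.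
  by split=> [|x xi]; rewrite ?nm ?lt; lia.
Qed.

Lemma tnodes_lam s : standard s -> tnodes (lam s) = size s.
Proof. by move=> ss; have [] := lam_fP ss (leqnSn _). Qed.

Lemma lsub_lam s i j : standard s ->
  lsub (lam s) i j <->
  i < j < size s /\ forall x, i <= x < j -> nth 0 s x < nth 0 s j.
Proof. by move=> ss; have [_ ->] := lam_fP ss (leqnSn _). Qed.

(* Galois connection between the weak order and the Tamari order. *)
Lemma lam_tle s r : standard s -> size s = tnodes r ->
  tle (lam s) r <-> forall i j, lsub r i j -> nth 0 s i < nth 0 s j.
Proof.
move=> ss sr; split=> [[_ H] i j rij|H].
  have /andP[ij _] := lsub_lt rij.
  by have /(lsub_lam _ _ ss)[_] := H i j rij; apply; rewrite leqnn.
split=> [|i j rij]; first by rewrite tnodes_lam.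
apply/lsub_lam => //; split; first by rewrite sr; exact: lsub_lt.
by move=> x xij; apply: H; exact: lsub_interval xij.
Qed.

(** * Restriction of a tree to a set of positions *)

Section Restriction.
Variables (r : tree) (L : seq nat).
Hypotheses (sL : sorted ltn L) (bL : all (ltn^~ (tnodes r)) L).

Let uL : uniq [seq nth 0 (gam r) x | x <- L].
Proof.
rewrite map_inj_in_uniq ?(sorted_uniq ltn_trans ltnn) //.
move=> x y /(allP bL) xr /(allP bL) yr /eqP.
by rewrite nth_uniq ?size_gam ?gam_uniq // => /eqP.
Qed.

(** [prestr] reads elements of [[n]], counted from 1, whereas [L] holds positions counted from 0. *)
Let prestrE :
  prestr (gam r) (map succn L) = st [seq nth 0 (gam r) x | x <- L].
Proof. by rewrite /prestr -map_comp. Qed.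

Lemma tnodes_trestr : tnodes (trestr r (map succn L)) = size L.
Proof.
by rewrite /trestr prestrE tnodes_lam ?st_standard // size_st size_map.
Qed.

(* [gamma] of a tree avoids a pattern, so restricting it yields again [gamma]
   of a tree: no information is lost by [lam] here. *)
Lemma lsub_trestr a b :
  lsub (trestr r (map succn L)) a b =
  (a < b < size L) && lsub r (nth 0 L a) (nth 0 L b).
Proof.
have ltL x y : x < y < size L -> nth 0 L x < nth 0 L y < tnodes r.
  move=> /andP[xy yL]; rewrite [_ < tnodes r](allP bL) ?mem_nth // andbT.
  by rewrite (sorted_ltn_nth ltn_trans) ?inE // (ltn_trans xy).
have E x : a <= x < b -> b < size L ->
    (nth 0 (st [seq nth 0 (gam r) x | x <- L]) x
      < nth 0 (st [seq nth 0 (gam r) x | x <- L]) b)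
    = lsub r (nth 0 L x) (nth 0 L b).
  move=> xab bL'; rewrite nth_st_lt ?size_map //; last by lia.
  by rewrite !(nth_map 0) ?lsub_gam ?ltL //; lia.
rewrite /trestr prestrE; apply/idP/andP => [|[ab rab]].
  move=> /lsub_lam[|]; first exact: st_standard.
  rewrite size_st size_map => ab H; split=> //.
  by rewrite -E ?H //; lia.
apply/lsub_lam; first exact: st_standard.
rewrite size_st size_map; split=> // x xab; rewrite E //; last by lia.
apply: lsub_interval rab _; have xb : x < b < size L by lia.
have /andP[-> _] := ltL _ _ xb; rewrite andbT.
have [->//|ax] := eqVneq a x.
have ax' : a < x < size L by lia.
by have /andP[/ltnW] := ltL _ _ ax'.
Qed.

End Restriction.

(** * Marked positions of a word *)

Definition positions (w : seq bool) : seq nat :=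
  [seq i <- iota 0 (size w) | nth false w i].

Lemma sorted_positions w : sorted ltn (positions w).
Proof. by apply: sorted_filter (iota_ltn_sorted _ _); exact: ltn_trans. Qed.

Lemma mem_positions w k : (k \in positions w) = nth false w k.
Proof.
rewrite mem_filter mem_iota /= add0n; case: ltnP => kw; first by rewrite andbT.
by rewrite nth_default.
Qed.

Lemma positions_lt w : all (ltn^~ (size w)) (positions w).
Proof. by apply/allP=> k; rewrite mem_filter mem_iota => /andP[]. Qed.

Lemma size_positions w : size (positions w) = count id w.
Proof.
by rewrite size_filter -{3}(mkseq_nth false w) /mkseq count_map.
Qed.

Lemma index_positions w k : nth false w k ->
  index k (positions w) = count id (take k w).
Proof.
move=> wk; have kw : k < size w.
  by rewrite ltnNge; apply/negP=> wk'; move: wk; rewrite nth_default.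
have -> : positions w = [seq i <- iota 0 k | nth false w i]
    ++ k :: [seq i <- iota k.+1 (size w - k.+1) | nth false w i].
  rewrite /positions -{1}(subnKC kw) addSnnS iotaD filter_cat /=.
  by rewrite add0n wk.
rewrite index_cat mem_filter mem_iota add0n ltnn /= eqxx addn0 size_filter.
by rewrite andbF -[in RHS](map_nth_iota0 false (ltnW kw)) count_map.
Qed.

Lemma nth_positions w k : nth false w k ->
  nth 0 (positions w) (count id (take k w)) = k.
Proof. by move=> wk; rewrite -index_positions // nth_index // mem_positions. Qed.

Lemma positions_nth w a : a < count id w ->
  nth false w (nth 0 (positions w) a) /\
  count id (take (nth 0 (positions w) a) w) = a.
Proof.
move=> aw; have wk : nth false w (nth 0 (positions w) a).
  by rewrite -mem_positions mem_nth ?size_positions.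
split=> //; rewrite -index_positions // index_uniq ?size_positions //.
by rewrite (sorted_uniq ltn_trans ltnn) // sorted_positions.
Qed.

Lemma count_take_mono (P : pred bool) i j w :
  i <= j -> count P (take i w) <= count P (take j w).
Proof. by move=> ij; rewrite -(take_takel w ij) count_take_le. Qed.

Lemma count_take_smono (P : pred bool) i j w :
  i < j <= size w -> P (nth false w i) -> count P (take i w) < count P (take j w).
Proof.
move=> /andP[ij jw] Pi; rewrite -(take_takel w (ltnW ij)).
by apply: (@count_take_lt _ false); rewrite ?nth_take // size_takel.
Qed.

(** Counting the [true]s before a position inverts [positions w], so the comparison with a
    restriction of [r] can be tested on the nodes of [r] themselves. *)
Lemma tle_trestr t r w : size w = tnodes r -> count id w = tnodes t ->
  tle t (trestr r (map succn (positions w))) <->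
  forall i j, lsub r i j -> nth false w i -> nth false w j ->
    lsub t (count id (take i w)) (count id (take j w)).
Proof.
move=> wr ct; have bw : all (ltn^~ (tnodes r)) (positions w).
  by rewrite -wr positions_lt.
split=> [[_ H] i j rij wi wj|H].
  have /andP[ij jr] := lsub_lt rij.
  apply: H; rewrite lsub_trestr ?sorted_positions // !nth_positions // rij andbT.
  rewrite size_positions (@count_take_lt _ false) ?wr ?andbT //.
  by apply: count_take_smono; rewrite ?ij //= wr ltnW.
split=> [|a b]; first by rewrite tnodes_trestr ?sorted_positions // size_positions.
rewrite lsub_trestr ?sorted_positions // size_positions => /andP[/andP[ab bt] rab].
have [wa ca] := positions_nth (ltn_trans ab bt).
have [wb cb] := positions_nth bt.
by rewrite -ca -cb; exact: H.
Qed.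

(** * Comparison of a shuffle with a tree *)

Lemma count_negb_take (k : nat) w :
  count id (take k (map negb w)) = count negb (take k w).
Proof. by rewrite -map_take count_map. Qed.

(* If [i] lies below [j] on the left in [r], so does every node between them.
   Hence, when both come from [t], no node of [s] separates them, and when only
   [i] comes from [t], the nodes of [s] between them are to the left of [j]. *)
Lemma shuffle_tle t s r w :
  count id w = tnodes t -> count negb w = tnodes s -> size w = tnodes r ->
  tle (shuffle t s w) r <->
  [/\ forall i j, lsub r i j -> nth false w j -> nth false w i,
      tle t (trestr r (map succn (positions w)))
    & tle s (trestr r (map succn (positions (map negb w))))].
Proof.
move=> ct cs wr.
have Et := tle_trestr wr ct.
have [|| Es1 Es2] := @tle_trestr s r (map negb w); rewrite ?size_map ?count_map //.
have nw i : i < size w -> nth false (map negb w) i = ~~ nth false w i.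
  by move=> iw; rewrite (nth_map false).
have blt i j : lsub r i j -> i < j < size w by rewrite wr; exact: lsub_lt.
have Flt i j : i < j < size w -> ~~ nth false w i ->
    count negb (take i w) < count negb (take j w).
  by move=> ij wi; apply: count_take_smono => //; lia.
split=> [[_ H]|[Hts /Et Ht /Es1 Hs]].
  split; [move=> i j rij wj | apply/Et=> i j rij wi wj | apply: Es2 => i j rij].
  - have := H i j rij; rewrite lsub_shuffle ?blt // wj => /andP[/eqP e _].
    by apply: contraT => wi; have := Flt _ _ (blt _ _ rij) wi; rewrite e ltnn.
  - by have := H i j rij; rewrite lsub_shuffle ?blt // wj => /andP[].
  - have ij := blt _ _ rij; rewrite !nw ?count_negb_take; try lia.
    move=> wi wj; have := H i j rij; rewrite lsub_shuffle // (negbTE wj).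
    by case/orP=> [/eqP e|//]; have := Flt _ _ ij wi; rewrite e ltnn.
split=> [|i j rij]; first by rewrite tnodes_shuffle.
have ij := blt _ _ rij; rewrite lsub_shuffle //.
have [e|neF] := eqVneq (count negb (take i w)) (count negb (take j w)).
  by case: ifP => //= wj; apply: Ht => //; exact: Hts rij wj.
(* The witness [x] is the first node of [s] at or after [i]: the [false] preceded by as many
   [false]s as [i] is. It lies before [j], so it can replace [i] by [lsub_interval]. *)
have [x [xij wx <-]] : exists x, [/\ i <= x < j, ~~ nth false w x
    & count negb (take x w) = count negb (take i w)].
  have Fij : count negb (take i w) < count negb (take j w).
    by rewrite ltn_neqAle neF count_take_mono //; lia.
  have [|wx Fx] := @positions_nth (map negb w) (count negb (take i w)).
    by rewrite count_map (leq_trans Fij) // count_take_le.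
  set x := nth 0 _ _ in wx Fx; rewrite count_negb_take in Fx.
  have xw : x < size w.
    by rewrite ltnNge; apply/negP=> wx'; rewrite nth_default ?size_map in wx.
  rewrite nw // in wx; exists x; split=> //; apply/andP; split.
    rewrite leqNgt; apply/negP=> xi; have xiw : x < i < size w by lia.
    by have := Flt _ _ xiw wx; rewrite Fx ltnn.
  rewrite ltnNge; apply/negP=> jx; move: Fij; rewrite -Fx ltnNge.
  by rewrite count_take_mono.
have rxj := lsub_interval rij xij.
case: ifP => wj; first by have := Hts _ _ rxj wj; rewrite (negbTE wx).
rewrite -!count_negb_take; apply: Hs => //; rewrite nw ?wj //; lia.
Qed.

(** * The permutation [piR] *)

Definition set_word n (R : {set 'I_n}) : seq bool := [seq i \in R | i <- enum 'I_n].

Lemma size_set_word n (R : {set 'I_n}) : size (set_word R) = n.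
Proof. by rewrite size_map size_enum_ord. Qed.

Lemma count_set_word n (R : {set 'I_n}) :
  count id (set_word R) + count negb (set_word R) = n.
Proof. exact: etrans (count_predC id _) (size_set_word R). Qed.

Lemma nth_set_word n (R : {set 'I_n}) (i : 'I_n) :
  nth false (set_word R) i = (i \in R).
Proof. by rewrite (nth_map i) ?size_enum_ord // nth_ord_enum. Qed.

Lemma set_wordC n (R : {set 'I_n}) : set_word (~: R) = map negb (set_word R).
Proof. by rewrite -map_comp; apply: eq_map => i; rewrite /= inE. Qed.

Lemma RlE n (R : {set 'I_n}) : Rl R = map succn (positions (set_word R)).
Proof.
rewrite /Rl /positions size_set_word -val_enum_ord filter_map -map_comp.
rewrite enumT /enum_mem; congr map; apply: eq_filter => i.
by rewrite /= nth_set_word.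
Qed.

Lemma RclE n (R : {set 'I_n}) :
  Rcl R = map succn (positions (map negb (set_word R))).
Proof. by rewrite -set_wordC -RlE. Qed.

Lemma set_word_inj n : injective (@set_word n).
Proof. by move=> R S E; apply/setP=> i; rewrite -!nth_set_word E. Qed.

Lemma set_word_surj n w : size w = n -> exists R : {set 'I_n}, set_word R = w.
Proof.
move=> sw; exists [set i : 'I_n | nth false w i].
apply: (@eq_from_nth _ false); first by rewrite size_set_word sw.
move=> i; rewrite size_set_word => ltin.
by rewrite (nth_set_word _ (Ordinal ltin)) inE.
Qed.

Section PiR.
Variables (n : nat) (R : {set 'I_n}).
Let w := set_word R.

Lemma size_piR : size (piR R) = n.
Proof. by rewrite size_map size_iota. Qed.

Lemma nth_piR k : k < n ->
  nth 0 (piR R) k =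
  (if nth false w k then count id (take k w)
   else count id w + count negb (take k w)).+1.
Proof.
move=> kn; rewrite (nth_map 0) ?size_iota // nth_iota // add1n RlE RclE.
rewrite (mem_map succn_inj) mem_positions size_map size_positions.
rewrite !(index_map succn_inj) -/w; case: ifP => wk; first by rewrite index_positions.
rewrite index_positions ?count_negb_take //.
by rewrite (nth_map false) ?wk // size_set_word.
Qed.

(** [piR R] is increasing on [R] and on its complement, and gives the smallest values to [R]; this
    determines its inversions. *)
Lemma nth_piR_lt i j : i < j < n ->
  if nth false w j && ~~ nth false w i then nth 0 (piR R) j < nth 0 (piR R) i
  else nth 0 (piR R) i < nth 0 (piR R) j.
Proof.
move=> ij; have sw : size w = n by exact: size_set_word.
rewrite !nth_piR; try lia.
have Tlt k : k < n -> nth false w k -> count id (take k w) < count id w.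
  by move=> kn wk; rewrite (@count_take_lt _ false) ?sw.
have := @count_take_smono id i j w; have := @count_take_smono negb i j w.
have := Tlt i; have := Tlt j; rewrite sw.
case: (nth false w i); case: (nth false w j) => /=; lia.
Qed.

Lemma standard_piR : standard (piR R).
Proof.
have sw : size w = n by exact: size_set_word.
apply/andP; split.
  apply/(uniqP 0) => i j; rewrite !inE size_piR => ltin ltjn e.
  case: (ltngtP i j) => // lt.
    by have := @nth_piR_lt i j; rewrite e ltnn lt ltjn if_same => /(_ isT).
  by have := @nth_piR_lt j i; rewrite e ltnn lt ltin if_same => /(_ isT).
apply/(all_nthP 0) => k; rewrite size_piR => kn; rewrite nth_piR //=.
have := count_set_word R; rewrite -/w => cw.
have := @count_take_lt _ false id k w; have := @count_take_lt _ false negb k w.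
by rewrite sw; case: (nth false w k) => /=; lia.
Qed.

(** By the Galois connection, no pair of [lsub r] may be an inversion of [piR R], that is, start
    outside [R] and end inside it. *)
Lemma lam_piR_tle r : tnodes r = n ->
  tle (lam (piR R)) r <->
  forall i j, lsub r i j -> nth false w j -> nth false w i.
Proof.
move=> rn; rewrite lam_tle ?standard_piR ?size_piR //.
have ltP i j : lsub r i j -> i < j < n by move=> /lsub_lt; rewrite rn.
split=> H i j rij; have := nth_piR_lt (ltP _ _ rij).
  move=> + wj; rewrite wj /=; case: (nth false w i) => //=.
  by rewrite ltnNge ltnW // H.
by have := H i j rij; case: (nth false w j) => //= ->.
Qed.

End PiR.

(** * Counting the shuffles below a given tree *)

Lemma shuffle_tle_set n (R : {set 'I_n}) t s r :
  count id (set_word R) = tnodes t -> count negb (set_word R) = tnodes s ->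
  tnodes r = n ->
  tamari_le (shuffle t s (set_word R)) r =
  [&& tamari_le (lam (piR R)) r, tamari_le t (trestr r (Rl R))
    & tamari_le s (trestr r (Rcl R))].
Proof.
move=> ct cs rn; have swr : size (set_word R) = tnodes r by rewrite size_set_word.
apply/tamariP/and3P => [|[/tamariP H1 /tamariP H2 /tamariP H3]].
  move=> /(shuffle_tle ct cs swr)[H1 H2 H3].
  by split; apply/tamariP; rewrite ?RlE ?RclE //; apply/(lam_piR_tle _ rn).
apply/(shuffle_tle ct cs swr); rewrite -RlE -RclE; split=> //.
exact/(lam_piR_tle _ rn).
Qed.

(** Stars and bars: multisets of [q] of the [p + 1] leaves correspond to [p]-subsets of [p + q]
    positions, by [mask_mset 0] and [mset_mask 0 p]. *)
Lemma perm_msets p q :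
  perm_eq (msets q 0 p)
    [seq mask_mset 0 (set_word R)
      | R <- enum [set R : {set 'I_(p + q)} | count id (set_word R) == p]].
Proof.
apply: uniq_perm; first exact: msets_uniq.
  rewrite map_inj_in_uniq ?enum_uniq // => R S; rewrite !mem_enum !inE.
  move=> /eqP cR /eqP cS e; apply: set_word_inj.
  by rewrite -(mask_msetK 0 (set_word R)) -(mask_msetK 0 (set_word S)) cR cS e.
move=> m; rewrite mem_msets; apply/and3P/mapP => [[/eqP sm pm am]|].
  have [|c1 c2] := count_mset_mask pm am; first by [].
  have [|R ER] := @set_word_surj (p + q) (mset_mask 0 p m).
    by rewrite -(count_predC id) c1 subn0 c2 sm.
  exists R; last by rewrite ER mset_maskK.
  by rewrite mem_enum inE ER c1 subn0.
move=> [R]; rewrite mem_enum inE => /eqP cR ->.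
rewrite size_mask_mset path_mask_mset; split=> //.
  by have := count_set_word R; rewrite cR => /addnI ->.
by have := mask_mset_le 0 (set_word R); rewrite cR.
Qed.

Lemma count_graft_tle p q t s r :
  tnodes t = p -> tnodes s = q -> tnodes r = p + q ->
  count (fun m => tamari_le (graft (multisplit t m) s) r) (msets q 0 p) =
  #|[set R : {set 'I_(p + q)} | [&& tamari_le (lam (piR R)) r,
       tamari_le t (trestr r (Rl R)) & tamari_le s (trestr r (Rcl R))]]|.
Proof.
move=> tp sq rn; rewrite (permP (perm_msets p q)) count_map.
rewrite cardE -size_filter; congr size.
rewrite /enum_mem -filter_predI; apply: eq_filter => R /=.
rewrite !inE /=; have [cR|ncR] := eqVneq (count id (set_word R)) p.
  rewrite andbT -[graft _ _]/(shuffle t s (set_word R)).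
  rewrite shuffle_tle_set ?tp ?sq //.
  by have := count_set_word R; rewrite cR => /addnI.
(* A set [R] of the wrong size is excluded automatically, since the restriction of [r] to [R] then
   differs from [t] in its number of nodes. *)
rewrite andbF; apply/esym/negP => /and3P[_ /tamariP[+ _] _].
rewrite RlE tnodes_trestr ?sorted_positions // ?size_positions ?tp.
  by move=> e; case/eqP: ncR.
by have := positions_lt (set_word R); rewrite size_set_word rn.
Qed.

(** * Moebius inversion *)

Local Open Scope ring_scope.

(** Measure for the recursion of [mu_f]: it drops whenever the upper end of the interval is replaced
    by a smaller tree. *)
Definition downset_size (s : tree) : nat :=
  count (tamari_le^~ s) (trees (tnodes s)).

Lemma downset_size_lt u s : tle u s -> u != s -> (downset_size u < downset_size s)%N.
Proof.
move=> us neq; have eus := us.1; rewrite /downset_size eus.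
apply: (@sub_count_lt _ _ _ s) => [v /tamariP vu|||].
- by apply/tamariP; exact: tle_trans us.
- by rewrite mem_trees.
- by apply/tamariP; exact: tle_refl.
- by apply: contra neq => /tamariP su; rewrite (tle_anti us su).
Qed.

Lemma downset_size_gt0 s : (0 < downset_size s)%N.
Proof.
rewrite -has_count; apply/hasP; exists s; first by rewrite mem_trees.
by apply/tamariP; exact: tle_refl.
Qed.

Lemma mu_f_fuel k k' t s :
  (downset_size s <= k)%N -> (downset_size s <= k')%N -> mu_f k t s = mu_f k' t s.
Proof.
elim: k k' s => [|k IHk] [|k'] s sk sk' //; try by have := downset_size_gt0 s; lia.
rewrite /=; case: ifP => // _; case: ifP => // _.
congr (- _); apply: eq_bigr => u /andP[/andP[_ /tamariP us] neq].
by have lt := downset_size_lt us neq; apply: IHk; lia.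
Qed.

Lemma mobius_refl t : mobius t t = 1.
Proof. by rewrite /mobius eqxx /= eqxx. Qed.

Lemma mobius_eq0 t s : ~~ tamari_le t s -> mobius t s = 0.
Proof.
move=> nts; rewrite /mobius; case: ifP => //= _; rewrite (negbTE nts).
case: eqP => // e; case/negP: nts; rewrite e; apply/tamariP; exact: tle_refl.
Qed.

Lemma mobius_rec t s : tle t s -> s != t ->
  mobius t s = - \sum_(u <- trees (tnodes t) | (u != s) && tamari_le u s) mobius t u.
Proof.
move=> ts neq; have ets := ts.1.
rewrite {1}/mobius ets eqxx /= (negbTE neq) (introT (tamariP _ _) ts) -ets.
congr (- _); rewrite [LHS]big_mkcond [RHS]big_mkcond /=.
apply: eq_big_seq => u; rewrite mem_trees => /eqP eu.
(* The recursion of [mu_f] sums only over [u] above [t]; the additional terms here vanish. *)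
have [tu|ntu] := boolP (tamari_le t u); last by rewrite mobius_eq0 // if_same.
rewrite andbC; case: ifP => //= /andP[un /tamariP us]; rewrite /mobius eu eqxx.
have lt := downset_size_lt us un.
have le : (downset_size s <= size (trees (tnodes t)))%N.
  by rewrite /downset_size ets count_size.
by apply: mu_f_fuel; lia.
Qed.

Lemma mobius_zeta n t s : tnodes t = n ->
  \sum_(u <- trees n | tamari_le u s) mobius t u = (t == s)%:R.
Proof.
move=> tn; have [ts|nts] := boolP (tamari_le t s); last first.
  rewrite big1 => [|u us]; last first.
    apply: mobius_eq0; apply: contra nts => /tamariP tu.
    by apply/tamariP; apply: tle_trans tu _; exact/tamariP.
  case: eqP => // e; case/negP: nts; rewrite e; apply/tamariP; exact: tle_refl.
have /tamariP lts := ts.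
have st : s \in trees n by rewrite mem_trees -tn lts.1.
rewrite big_mkcond (bigD1_seq s) ?trees_uniq //= -big_mkcondr.
rewrite (introT (tamariP s s) (tle_refl s)).
have [<-|neq] := eqVneq t s.
  rewrite mobius_refl big1 ?addr0 // => u /andP[neq /tamariP ut].
  apply: mobius_eq0; apply: contra neq => /tamariP tu.
  by rewrite (tle_anti ut tu).
by rewrite mobius_rec ?[s == t]eq_sym // tn addNr.
Qed.

(** The recursion makes the Moebius matrix a left inverse of the zeta matrix. Both are square and
    finite, so it is a right inverse too. *)
Lemma zeta_mobius n t s : tnodes t = n -> tnodes s = n ->
  \sum_(u <- trees n | tamari_le t u) mobius u s = (t == s)%:R.
Proof.
move=> tn sn; set N := size (trees n); pose tt (i : 'I_N) := nth Leaf (trees n) i.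
pose Z : 'M[rat]_N := \matrix_(i, j) (tamari_le (tt i) (tt j))%:R.
pose Mo : 'M[rat]_N := \matrix_(i, j) mobius (tt i) (tt j).
have ttn i : tnodes (tt i) = n by apply/eqP; rewrite -mem_trees mem_nth.
have tt_eq i j : (tt i == tt j) = (i == j) by rewrite nth_uniq ?trees_uniq.
have sumE (F : tree -> rat) : \sum_(u <- trees n) F u = \sum_(i < N) F (tt i).
  by rewrite (big_nth Leaf) big_mkord.
have ttP u : tnodes u = n -> exists i, u = tt i.
  move=> un; have ut : u \in trees n by rewrite mem_trees un.
  have ui : (index u (trees n) < N)%N by rewrite index_mem.
  by exists (Ordinal ui); rewrite /tt nth_index.
have /mulmx1C/matrixP MZ : Mo *m Z = 1%:M.
  apply/matrixP=> i j; rewrite !mxE -tt_eq -(@mobius_zeta n) // [RHS]big_mkcond sumE.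
  apply: eq_bigr => k _; rewrite !mxE.
  by case: ifP => _; rewrite ?mulr1 ?mulr0.
have [i ->] := ttP t tn; have [j ->] := ttP s sn.
have := MZ i j; rewrite !mxE tt_eq => <-; rewrite [LHS]big_mkcond sumE.
apply: eq_bigr => k _; rewrite !mxE.
by case: ifP => _; rewrite ?mul1r ?mul0r.
Qed.

(** * The product in the Moebius basis *)

Lemma tnodes_graft_msets p q t s m : tnodes t = p -> tnodes s = q ->
  m \in msets q 0 p -> tnodes (graft (multisplit t m) s) = (p + q)%N.
Proof.
move=> tp sq; rewrite (perm_mem (perm_msets p q)) => /mapP[R].
rewrite mem_enum inE => /eqP cR ->.
rewrite -[graft _ _]/(shuffle t s (set_word R)) tnodes_shuffle ?size_set_word ?tp //.
by have := count_set_word R; rewrite cR sq => /addnI.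
Qed.

Lemma natr_count (T : Type) (P : pred T) (s : seq T) :
  (count P s)%:R = \sum_(x <- s) (P x)%:R :> rat.
Proof. by rewrite -sum1_count natr_sum big_mkcond; apply: eq_bigr => x _; case: ifP. Qed.

(** Every term [F_v] of the product expands as the sum of the [M_r] with [v <= r]. Collecting by [r]
    leaves the number of shuffles below [r], which [count_graft_tle] expresses through subsets. *)
Lemma mulF_mobius p q t s u :
  tnodes t = p -> tnodes s = q -> tnodes u = (p + q)%N ->
  mulF t s u = \sum_(r <- trees (p + q)) \sum_(R : {set 'I_(p + q)})
    (tamari_le (lam (piR R)) r)%:R * (tamari_le t (trestr r (Rl R)))%:R
    * (tamari_le s (trestr r (Rcl R)))%:R * mobius r u.
Proof.
move=> tp sq un; rewrite /mulF tp sq natr_count.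
transitivity (\sum_(m <- msets q 0 p) \sum_(r <- trees (p + q))
    (tamari_le (graft (multisplit t m) s) r)%:R * mobius r u).
  apply: eq_big_seq => m mm; rewrite -(@zeta_mobius (p + q)) //; last first.
    exact: tnodes_graft_msets mm.
  rewrite big_mkcond; apply: eq_bigr => r _.
  by case: ifP => _; rewrite ?mul1r ?mul0r.
rewrite exchange_big; apply: eq_big_seq => r; rewrite mem_trees => /eqP rn.
rewrite -mulr_suml -natr_count count_graft_tle // -mulr_suml; congr (_ * _).
rewrite -sum1_card natr_sum big_mkcond; apply: eq_bigr => R _; rewrite inE.
by do 3![case: (tamari_le _ _)]; rewrite ?mulr0 ?mul0r ?mulr1.
Qed.

(* Dual form of Delta(M*_r) = sum_{R, lambda(pi_R) <= r} M*_{r|R} (x) M*_{r|R^c}: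
   for all a in Y_p, b in Y_q, the product M_a . M_b in YSym equals
   sum_{r in Y_(p+q)} #{R : lambda(pi_R) <= r, r|_R = a, r|_{R^c} = b} M_r. *)
Theorem theorem8p6 (p q : nat) (a b : tree) :
  tnodes a = p -> tnodes b = q ->
  forall u : tree,
    mulv p q (Mvec a) (Mvec b) u
    = \sum_(r <- trees (p + q)) (coeff_count (p + q) r a b)%:R * Mvec r u.
Proof.
move=> ap bq u; rewrite /mulv /Mvec.
have [un|nun] := eqVneq (tnodes u) (p + q)%N; last first.
  (* Both sides are homogeneous of degree [p + q], so they vanish at a [u] of any other degree. *)
  transitivity (0 : rat); last first.
    apply/esym; rewrite big_seq big1 // => r; rewrite mem_trees => /eqP rn.
    by rewrite /mobius rn (negbTE nun) mulr0.
  rewrite big_seq big1 // => t; rewrite mem_trees => /eqP tp.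
  rewrite big_seq big1 // => s; rewrite mem_trees => /eqP sq.
  rewrite /mulF tp sq (_ : count _ _ = 0%N) ?mulr0 //.
  apply/eqP; rewrite -leqn0 leqNgt -has_count; apply/hasPn => m mm.
  by apply: contra nun => /eqP <-; rewrite (tnodes_graft_msets tp sq mm).
pose D r t s (R : {set 'I_(p + q)}) : rat :=
  (tamari_le (lam (piR R)) r)%:R * (tamari_le t (trestr r (Rl R)))%:R
    * (tamari_le s (trestr r (Rcl R)))%:R * mobius r u.
(* With [r] and [R] outermost, the sums over [t] and [s] factor into two separate Moebius sums. *)
transitivity (\sum_(r <- trees (p + q)) \sum_(R : {set 'I_(p + q)})
    \sum_(t <- trees p) \sum_(s <- trees q) mobius a t * mobius b s * D r t s R).
  transitivity (\sum_(t <- trees p) \sum_(s <- trees q) \sum_(r <- trees (p + q))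
      \sum_(R : {set 'I_(p + q)}) mobius a t * mobius b s * D r t s R).
    apply: eq_big_seq => t; rewrite mem_trees => /eqP tp.
    apply: eq_big_seq => s; rewrite mem_trees => /eqP sq.
    rewrite (mulF_mobius tp sq un) mulr_sumr; apply: eq_bigr => r _.
    by rewrite mulr_sumr.
  transitivity (\sum_(t <- trees p) \sum_(r <- trees (p + q)) \sum_(s <- trees q)
      \sum_(R : {set 'I_(p + q)}) mobius a t * mobius b s * D r t s R).
    by apply: eq_bigr => t _; rewrite exchange_big.
  rewrite exchange_big; apply: eq_bigr => r _.
  transitivity (\sum_(t <- trees p) \sum_(R : {set 'I_(p + q)}) \sum_(s <- trees q)
      mobius a t * mobius b s * D r t s R).
    by apply: eq_bigr => t _; rewrite exchange_big.
  by rewrite exchange_big.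
apply: eq_bigr => r _; rewrite /coeff_count -sum1_card natr_sum mulr_suml.
rewrite [RHS]big_mkcond; apply: eq_bigr => R _; rewrite inE.
(* The Moebius sums run over the trees below the two restrictions of [r], so [mobius_zeta] collapses
   them to equalities with [a] and [b]. *)
transitivity ((tamari_le (lam (piR R)) r)%:R * (a == trestr r (Rl R))%:R
    * (b == trestr r (Rcl R))%:R * mobius r u).
  rewrite -(mobius_zeta _ ap) [in RHS]big_mkcond mulr_sumr !mulr_suml.
  apply: eq_bigr => t _.
  rewrite -(mobius_zeta _ bq) [in RHS]big_mkcond mulr_sumr mulr_suml.
  apply: eq_bigr => s _; rewrite /D.
  by case: (tamari_le t _); case: (tamari_le s _); rewrite /=; ring.
rewrite [a == _]eq_sym [b == _]eq_sym.
by case: (tamari_le _ _); case: eqP; case: eqP; rewrite ?mul1r ?mulr1 ?mulr0 ?mul0r.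
Qed.
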